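(* Let $1\le p<\infty$, let $\Omega\subset\mathbb{R}^d$ be open and bounded, let $\nu:\mathbb{R}^d\setminus\{0\}\to[0,\infty)$ be measurable and symmetric ($\nu(h)=\nu(-h)$), and let $r>\rho\ge0$. Assume that - $\nu>0$ a.e. on $B_r(0)$; - $r\ge\operatorname{diam}(\Omega)$ or $\Omega$ is $\rho$-connected; - the embedding $W^p_\nu(\Omega)\hookrightarrow L^p(\Omega)$ is compact. Then there is $C=C(d,p,\Omega,\nu)>0$ such that $$\Big\|u-\frac{1}{|\Omega|}\int_\Omega u\,dx\Big\|^p_{L^p(\Omega)}\le C\int_\Omega\int_\Omega|u(x)-u(y)|^p\nu(x-y)\,dy\,dx\qquad\text{for all }u\in L^p(\Omega).$$
   Context: $W^p_\nu(\Omega)=\{u\in L^p(\Omega):\int_\Omega\int_\Omega|u(x)-u(y)|^p\nu(x-y)\,dy\,dx<\infty\}$ with norm $\big(\|u\|^p_{L^p(\Omega)}+\int_\Omega\int_\Omega|u(x)-u(y)|^p\nu(x-y)\,dy\,dx\big)^{1/p}$. For $\rho\ge0$, $\Omega$ is called $\rho$-connected if $\Omega=\Omega_1\cup\dots\cup\Omega_m$ for some $m\ge1$, where each $\Omega_i$ is open and connected and $\operatorname{dist}(\Omega_i,\Omega_{i+1})<\rho$ for $i=1,\dots,m-1$ (so every connected open set is $0$-connected, taking $m=1$). The right-hand side of the inequality may be $+\infty$. *)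

(* Defs.v *)
From HB Require Import structures.
From mathcomp Require Import all_boot all_order all_algebra.
From mathcomp Require Import all_classical all_reals all_analysis.

Set Implicit Arguments.
Unset Strict Implicit.
Unset Printing Implicit Defensive.

Import Order.TTheory GRing.Theory Num.Theory.
Import numFieldNormedType.Exports.

Local Open Scope classical_set_scope.
Local Open Scope ring_scope.

Section borel.
Variable R : realType.

(* 'rV[R]_n with the sigma-algebra generated by the coordinates, i.e. the Borel
   sets of R^n. *)
Definition borel_rV (n : nat) : Type := 'rV[R]_n.

HB.instance Definition _ n := Pointed.on (borel_rV n).

Definition rV_coord (n : nat) (i : 'I_n) (x : borel_rV n) : R := x ord0 i.

HB.instance Definition _ (n : nat) :=
  @isMeasurable.Build default_measure_display (borel_rV n)
    (g_sigma_preimage (@rV_coord n))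
    (@sigma_algebra0 _ setT _) (@sigma_algebraC _ _)
    (@sigma_algebra_bigcup _ setT _).

Definition rV_cons (n : nat) (xv : measurableTypeR R * borel_rV n) :
    borel_rV n.+1 :=
  row_mx (xv.1)%:M xv.2.

Lemma rV_cons0 n (xv : measurableTypeR R * borel_rV n) :
  rV_coord ord0 (rV_cons xv) = xv.1.
Proof.
rewrite /rV_coord /rV_cons mxE; case: splitP => [j _|//].
by rewrite mxE [j]ord1 eqxx mulr1n.
Qed.

Lemma rV_consS n (xv : measurableTypeR R * borel_rV n) (j : 'I_n) :
  rV_coord (lift ord0 j) (rV_cons xv) = rV_coord j xv.2.
Proof.
rewrite /rV_coord /rV_cons mxE; case: splitP => [k|k /eqP].
  by rewrite ord1.
by rewrite /= /bump /= eqSS => /eqP/val_inj ->.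
Qed.

Lemma measurable_rV_coord n (i : 'I_n) : measurable_fun setT (@rV_coord n i).
Proof.
move=> _ Y mY; rewrite setTI; apply: sub_sigma_algebra => /=.
rewrite -bigcup_seq/=; exists i => /=; first by rewrite mem_index_enum.
by exists Y => //; rewrite setTI.
Qed.

Lemma measurable_rV_cons n : measurable_fun setT (@rV_cons n).
Proof.
suff H : forall i : 'I_n.+1, measurable_fun setT (@rV_coord _ i \o @rV_cons n).
  move=> _ Y mY; rewrite setTI.
  pose M := [set A : set (borel_rV n.+1) | measurable (@rV_cons n @^-1` A)].
  suff : g_sigma_preimage (@rV_coord n.+1) `<=` M by exact.
  apply: smallest_sub.
    split.
    - by rewrite /M /= preimage_set0; exact: measurable0.
    - move=> A; rewrite /M /= setTD preimage_setC => mA; exact: measurableC.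
    - move=> F mF; rewrite /M /= preimage_bigcup.
      by apply: bigcup_measurable => k _; exact: mF.
  rewrite -bigcup_seq => A [i _ [B mB <-]]; rewrite setTI /M /=.
  by have := H i measurableT B mB; rewrite setTI.
move=> i; have [->|i0] := eqVneq i ord0.
  rewrite (_ : _ \o _ = fst); first exact: measurable_fst.
  by apply/funext => x /=; rewrite rV_cons0.
have [j ->] : exists j : 'I_n, i = lift ord0 j.
  by case: (unliftP ord0 i) i0 => [j ->|-> /eqP//]; exists j.
rewrite (_ : _ \o _ = @rV_coord n j \o snd); last first.
  by apply/funext => x /=; rewrite rV_consS.
exact: measurableT_comp (measurable_rV_coord j) measurable_snd.
Qed.

(* Each step is the product of the Lebesgue measure of the real line with the
   Lebesgue measure of the remaining coordinates. *)
Fixpoint borel_lebesgue (n : nat) : {measure set (borel_rV n) -> \bar R} :=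
  match n with
  | 0 => [the {measure set _ -> \bar R} of @dirac _ (borel_rV 0) 0 R]
  | m.+1 =>
    measure_function_pushforward__canonical__measure_function_Measure
      [the {measure set _ -> \bar R} of
        (lebesgue_measure \x^ borel_lebesgue m)%E] (@measurable_rV_cons m)
  end.

End borel.

Definition lebesgue_rV (R : realType) (n : nat) : measurableType _ :=
  caratheodory_type (borel_lebesgue R n)^*%mu.

(* Lebesgue measure on R^n, on the sigma-algebra of Lebesgue measurable sets. *)
Definition leb (R : realType) (n : nat) :
    {measure set (lebesgue_rV R n) -> \bar R} :=
  [the {measure set _ -> \bar R} of
    @completed_measure_extension _ _ _ (borel_lebesgue R n)].

Section notions.
Variables (R : realType) (d : nat).
Implicit Types (A B Omega : set 'rV[R]_d) (u v nu : 'rV[R]_d -> R) (p : R).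

(* The library norm on 'rV[R]_d is the sup norm: it gives the topology of R^d,
   but distances have to be measured with the Euclidean norm. *)
Definition enorm (x : 'rV[R]_d) : R := Num.sqrt (\sum_i x ord0 i ^+ 2).

Definition diam A : \bar R :=
  ereal_sup [set (enorm (xy.1 - xy.2))%:E | xy in A `*` A].

Definition set_dist A B : \bar R :=
  ereal_inf [set (enorm (xy.1 - xy.2))%:E | xy in A `*` B].

(* The sets U 0, ..., U m.-1 are the components; the empty set is at distance
   +oo from any set. *)
Definition rho_connected (rho : R) Omega : Prop :=
  exists m (U : nat -> set 'rV[R]_d),
    [/\ (0 < m)%N,
        Omega = \bigcup_(i < m) U i,
        (forall i, (i < m)%N -> open (U i) /\ connected (U i)) &
        (forall i, (i.+1 < m)%N -> (set_dist (U i) (U i.+1) < rho%:E)%E)].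

Definition Lp_norm p Omega u : \bar R :=
  ((\int[leb R d]_(x in Omega) (`|u x| `^ p)%:E) `^ p^-1)%E.

(* Functions are total on R^d, but only their values on Omega are used. *)
Definition in_Lp p Omega u : Prop :=
  @measurable_fun _ _ (lebesgue_rV R d) R Omega u /\
  (Lp_norm p Omega u < +oo)%E.

(* nu only matters off the origin: the integrand vanishes when x = y. *)
Definition energy p Omega nu u : \bar R :=
  (\int[leb R d]_(x in Omega) \int[leb R d]_(y in Omega)
     (`|u x - u y| `^ p * nu (x - y))%:E)%E.

Definition in_W p Omega nu u : Prop :=
  in_Lp p Omega u /\ (energy p Omega nu u < +oo)%E.

Definition W_norm p Omega nu u : \bar R :=
  ((Lp_norm p Omega u `^ p + energy p Omega nu u) `^ p^-1)%E.

(* The inclusion of W^p_nu(Omega) in L^p(Omega) is bounded by definition of the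
   norm, so only the compactness of the image of bounded sequences is at stake.
   Functions stand for their almost everywhere classes. *)
Definition compact_embedding p Omega nu : Prop :=
  forall u_ : nat -> 'rV[R]_d -> R,
    (forall n, in_W p Omega nu (u_ n)) ->
    (exists M : R, forall n, (W_norm p Omega nu (u_ n) <= M%:E)%E) ->
  exists (phi : nat -> nat) v,
    [/\ {homo phi : m n / (m < n)%N},
        in_Lp p Omega v &
        Lp_norm p Omega (u_ (phi n) \- v) @[n --> \oo] --> 0%E].

Definition average Omega u : R :=
  (fine (leb R d Omega))^-1 * \int[leb R d]_(x in Omega) u x.

End notions.

(* Main.v *)
Require Import Defs.
From HB Require Import structures.
From mathcomp Require Import all_boot all_order all_algebra.
From mathcomp Require Import all_classical all_reals all_analysis.
From mathcomp Require Import measurable_realfun ring lra.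

(** The proof is by contradiction and compactness. If no constant works, then
for every k some function violates the inequality with constant k + 1; after
subtracting its mean and normalizing
([normalized_counterexample]) this gives functions w_k of mean zero and L^p
norm one whose energies tend to 0. The sequence is bounded in W, so by the
compact embedding a subsequence converges in L^p to some v.

The energy of v should then vanish. The kernel nu need be neither bounded nor
Borel, so instead of passing to the limit in the energy itself one uses kernels
that are indicators of Borel sets B_k on which nu >= 1/(k+1)
([positive_kernel_cover]). For these the energy is continuous in L^p, as Omega
has finite measure ([energy_indicator_le]), and it is dominated by the original
energy ([energy_limit_eq0]). As the B_k exhaust almost all of the ball of radius
r, one gets v x = v y for almost every x and almost every y with |x - y| < r.

It follows that v is almost everywhere constant ([ae_constant]). Indeed v has a
well-defined value c z near each point z of Omega, with c x = c y as soon as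
|x - y| < r. Such a function is locally constant, hence constant on connected
sets; it takes the same value on two sets at distance less than rho < r; and if
the diameter of Omega is at most r, then all pairs of points of the open set
Omega are at distance less than r.

Finally, the functions w_k have mean zero and converge to v, so the constant is
0 ([mean_zero_cst_bound]), which contradicts the normalization of the w_k.

Two facts about Lebesgue measure are built on the way from its definition by
iterated products: null sets are invariant under y |-> x - y
([lebesgue_negligible_reflection]), and a set that is null near each of its
points is null ([negligible_local]). *)

Set Implicit Arguments.
Unset Strict Implicit.
Unset Printing Implicit Defensive.

Import Order.TTheory GRing.Theory Num.Theory.
Import numFieldNormedType.Exports.

Local Open Scope classical_set_scope.
Local Open Scope ring_scope.

(** * Elementary inequalities for powers *)

Section powR_inequalities.
Variables (R : realType) (p : R).
Implicit Types a b c t : R.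

(** Stands in for convexity when powers are integrated: the sum is at most three
times its largest term, whose power is one of those on the right. *)
Lemma powR_add3_le a b c : 0 <= p -> 0 <= a -> 0 <= b -> 0 <= c ->
  (a + b + c) `^ p <= 3 `^ p * (a `^ p + b `^ p + c `^ p).
Proof.
move=> p0 a0 b0 c0; pose m := Num.max a (Num.max b c).
have am : a <= m by rewrite le_max lexx.
have bm : b <= m by rewrite !le_max lexx orbT.
have cm : c <= m by rewrite !le_max lexx !orbT.
have m0 : 0 <= m by exact: le_trans am.
have mp : m `^ p <= a `^ p + b `^ p + c `^ p.
  have [ap bp cp] := And3 (powR_ge0 a p) (powR_ge0 b p) (powR_ge0 c p).
  rewrite /m; case: (leP b c) => _.
    case: (leP a c) => _; first by rewrite lerDr addr_ge0.
    by rewrite -addrA lerDl addr_ge0.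
  case: (leP a b) => _; last by rewrite -addrA lerDl addr_ge0.
  by rewrite -addrA addrCA lerDl addr_ge0.
apply: (@le_trans _ _ ((3 * m) `^ p)).
  by apply: ge0_ler_powR; rewrite ?nnegrE ?addr_ge0 ?mulr_ge0//; lra.
by rewrite powRM//; apply: ler_wpM2l => //; exact: powR_ge0.
Qed.

Lemma le_1D_powR t : 1 <= p -> 0 <= t -> t <= 1 + t `^ p.
Proof.
move=> p1 t0; have [t1|/ltW t1] := leP t 1.
  by rewrite (le_trans t1)// lerDl powR_ge0.
have : t `^ 1 <= t `^ p by exact: ler_powR.
by rewrite powRr1// => /le_trans; apply; rewrite lerDr.
Qed.

End powR_inequalities.

(** * Integrals of nonnegative functions *)

Section nonnegative_integrals.
Context d (T : measurableType d) (R : realType).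
Variables (mu : {measure set T -> \bar R}) (D : set T).
Implicit Types f g : T -> \bar R.
Local Open Scope ereal_scope.
Import HBNNSimple.

(** The integral of a nonnegative function is the supremum of the integrals of its
simple minorants, so monotonicity and the next inequality need no
measurability. This lets the energy be compared with a truncated one without
studying the measurability of its inner integral, where the kernel is
translated. *)
Lemma nonneg_le_integral f g : (forall x, D x -> 0 <= f x) ->
  (forall x, D x -> f x <= g x) ->
  \int[mu]_(x in D) f x <= \int[mu]_(x in D) g x.
Proof.
move=> f0 fg.
have g0 x : D x -> 0 <= g x by move=> Dx; exact: le_trans (f0 _ Dx) (fg _ Dx).
rewrite !ge0_integralE//; apply: ge_ereal_sup => _ [h /= hf <-].
apply: ereal_sup_ubound; exists h => // x.
by apply: le_trans (hf x) _; exact: lee_restrict.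
Qed.

Lemma nonneg_integralZl_le f (k : R) : (0 < k)%R ->
  (forall x, D x -> 0 <= f x) ->
  \int[mu]_(x in D) (k%:E * f x) <= k%:E * \int[mu]_(x in D) f x.
Proof.
move=> k0 f0; rewrite !ge0_integralE//; last first.
  by move=> x Dx; rewrite mule_ge0 ?f0// lee_fin ltW.
have kV0 : (0 <= k^-1)%R by rewrite invr_ge0 ltW.
apply: ge_ereal_sup => _ [h /= hf <-].
rewrite -lee_pdivrMl// -sintegralrM; apply: ereal_sup_ubound.
exists (scale_nnsfun h kV0) => // x; rewrite /= EFinM lee_pdivrMl//.
apply: le_trans (hf x) _; rewrite !patchE; case: ifPn => // _.
by rewrite mule0.
Qed.

Lemma ge0_integral_affine f g (k c : R) : measurable D ->
  measurable_fun D f -> measurable_fun D g ->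
  (forall x, 0 <= f x) -> (forall x, 0 <= g x) -> (0 <= k)%R -> (0 <= c)%R ->
  \int[mu]_(x in D) (k%:E * f x + g x + c%:E) =
  k%:E * \int[mu]_(x in D) f x + \int[mu]_(x in D) g x + c%:E * mu D.
Proof.
move=> mD mf mg f0 g0 k0 c0.
have kf0 x : 0 <= k%:E * f x by rewrite mule_ge0.
have mkf : measurable_fun D (fun x => k%:E * f x) by exact: measurable_funeM.
rewrite ge0_integralD//; last 2 first.
- by move=> x _; rewrite adde_ge0.
- exact: emeasurable_funD.
by rewrite ge0_integralD// ge0_integralZl// integral_cst.
Qed.

End nonnegative_integrals.

(** * Borel approximation of Caratheodory measurable sets *)

Section inner_regularity.
Context d (T : measurableType d) (R : realType).
Variable mu : {measure set T -> \bar R}.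
Local Open Scope ereal_scope.
Local Notation cT := (caratheodory_type mu^*%mu).
Local Notation cmu := (@completed_measure_extension _ T R mu).

Lemma measurable_caratheodory (A : set T) :
  measurable A -> (measurable : set (set cT)) A.
Proof.
by move=> mA; apply: sub_caratheodory; exact: sub_sigma_algebra.
Qed.

(** The intersection of a sequence of countable covers of X whose total measures
tend to the outer measure of X. *)
Lemma borel_hull (X : set T) : mu^*%mu X < +oo ->
  exists F : set T, [/\ measurable F, X `<=` F & mu F = mu^*%mu X].
Proof.
move=> Xoo.
have Xfin : mu^*%mu X \is a fin_num by rewrite ge0_fin_numE// outer_measure_ge0.
have cover n : exists A : set T, [/\ measurable A, X `<=` A &
    mu A <= mu^*%mu X + n.+1%:R^-1%:E].
  have n0 : (0 < n.+1%:R^-1 :> R)%R by rewrite invr_gt0.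
  have [_ /= [A XA <-] Alt] := lb_ereal_inf_adherent n0 Xfin.
  exists (\bigcup_k A k); split.
  - by apply: bigcupT_measurable => k; exact: (cover_measurable XA).
  - exact: cover_subset XA.
  apply: le_trans (ltW Alt).
  apply: measure_sigma_subadditive => //.
  - by move=> k; exact: (cover_measurable XA).
  - by apply: bigcupT_measurable => k; exact: (cover_measurable XA).
have [A] := choice cover => AP.
have mA : measurable (\bigcap_k A k).
  by apply: bigcapT_measurable => k; have [] := AP k.
exists (\bigcap_k A k); split=> //.
- by move=> x Xx k _; have [_ + _] := AP k; apply.
apply/eqP; rewrite eq_le; apply/andP; split; last first.
  rewrite -(measurable_mu_extE mu mA); apply: le_outer_measure => x Xx k _.
  by have [_ + _] := AP k; apply.
apply/lee_addgt0Pr => e e0.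
have [n ne] : exists n, (n.+1%:R^-1 < e :> R)%R.
  by have [n _ /(_ n (leqnn _))] := near_infty_natSinv_lt (PosNum e0); exists n.
have [mAn _ Ale] := AP n.
apply: (@le_trans _ _ (mu (A n))).
  by apply: le_measure; rewrite ?inE//; exact: bigcap_inf.
by apply: le_trans Ale _; rewrite leeD2l// lee_fin ltW.
Qed.

(** The complement of a Borel hull of [K `\` E]: what is lost, namely the part of
the hull lying inside E, is null because the hull has the same measure as
[K `\` E]. *)
Lemma borel_inner_set (K E : set T) : measurable K -> mu K < +oo ->
  (measurable : set (set cT)) E -> E `<=` K ->
  exists B : set T, [/\ measurable B, B `<=` E & cmu.-negligible (E `\` B)].
Proof.
move=> mK Koo mE EK.
have mKE : (measurable : set (set cT)) (K `\` E).
  by apply: measurableD => //; exact: measurable_caratheodory.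
have KEoo : mu^*%mu (K `\` E) < +oo.
  apply: le_lt_trans Koo; rewrite -(measurable_mu_extE mu mK).
  by apply: le_outer_measure => x [].
have [F [mF KEF muF]] := borel_hull KEoo.
exists (K `\` F); split; first exact: measurableD.
- by move=> x [Kx nFx]; apply: contrapT => nEx; apply: nFx; apply: KEF.
exists (F `\` (K `\` E)); split.
- by apply: measurableD => //; exact: measurable_caratheodory.
- have : cmu (F `\` (K `\` E)) = 0.
    rewrite measureD//=; last 2 first.
    + exact: measurable_caratheodory.
    + by rewrite /completed_measure_extension measurable_mu_extE// muF.
    rewrite setIidr// /completed_measure_extension measurable_mu_extE// muF.
    by rewrite subee// ge0_fin_numE// outer_measure_ge0.
  by [].
- move=> x [Ex nKF]; split; last by case=> _ /(_ Ex).
  by apply: contrapT => nFx; apply: nKF; split => //; exact: EK.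
Qed.

End inner_regularity.

(** * Measurability of partial integrals *)

Section measurable_section_integral.
Context d1 d2 (T1 : measurableType d1) (T2 : measurableType d2) (R : realType).
Variables (mu : {measure set T2 -> \bar R}).

(** The measurability part of Tonelli's theorem, with sigma-finiteness as a
hypothesis, for measures that do not carry it as a structure. *)
Lemma measurable_section_integral (f : T1 * T2 -> \bar R) :
  sigma_finite setT mu -> measurable_fun setT f -> (forall xy, 0 <= f xy)%E ->
  measurable_fun setT (fun x => \int[mu]_y f (x, y))%E.
Proof.
move=> smu; pose sf := isSFinite.Build _ _ _ (Measure.sort mu)
  (sfinite_measure_sigma_finite smu).
pose sg := isSigmaFinite.Build _ _ _ (Measure.sort mu) smu.
pose m : {sigma_finite_measure set T2 -> \bar R} :=
  HB.pack (Measure.sort mu) sf sg.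
exact: (@measurable_fun_fubini_tonelli_F _ _ _ _ _ m).
Qed.

End measurable_section_integral.

(** * Lebesgue measure on row vectors *)

Section lebesgue_rV.
Variable R : realType.
Implicit Types n : nat.
Local Open Scope ereal_scope.

Lemma measurable_to_borel_rV d (T : measurableType d) n
    (f : T -> borel_rV R n) :
  (forall i, measurable_fun setT (@rV_coord R n i \o f)) ->
  measurable_fun setT f.
Proof.
move=> mf _ Y mY; rewrite setTI.
pose M := [set A : set (borel_rV R n) | measurable (f @^-1` A)].
suff : g_sigma_preimage (@rV_coord R n) `<=` M by exact.
apply: smallest_sub.
  split.
  - by rewrite /M /= preimage_set0; exact: measurable0.
  - move=> A; rewrite /M /= setTD preimage_setC => mA; exact: measurableC.
  - move=> F mF; rewrite /M /= preimage_bigcup.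
    by apply: bigcup_measurable => k _; exact: mF.
rewrite -bigcup_seq => A [i _ [B mB <-]]; rewrite setTI /M /=.
by have := mf i measurableT B mB; rewrite setTI.
Qed.

Lemma measurable_rV_sub n (x : borel_rV R n) :
  measurable_fun setT (fun y : borel_rV R n => (x - y)%R : borel_rV R n).
Proof.
apply: measurable_to_borel_rV => i.
rewrite (_ : _ \o _ = (fun y => rV_coord i x - rV_coord i y)%R).
  by apply: measurable_funB => //; exact: measurable_rV_coord.
by apply/funext => y; rewrite /= /rV_coord !mxE.
Qed.

Lemma ball_rVP n (a : 'rV[R]_n) (e : R) (x : 'rV[R]_n) : (0 < e)%R ->
  ball a e x <-> forall j, ball (a ord0 j) e (x ord0 j).
Proof.
move=> e0; split => [[_ H] j|H]; first exact: H.
by split=> // i j; rewrite [i]ord1.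
Qed.

Lemma rV_cons_coord0 n (xv : measurableTypeR R * borel_rV R n) :
  rV_cons xv ord0 ord0 = xv.1.
Proof. exact: rV_cons0. Qed.

Lemma rV_cons_coordS n (xv : measurableTypeR R * borel_rV R n) (j : 'I_n) :
  rV_cons xv ord0 (lift ord0 j) = xv.2 ord0 j.
Proof. exact: rV_consS. Qed.

Lemma ball_rV_cons n (a : 'rV[R]_n.+1) (e : R) t (v : borel_rV R n) :
  (0 < e)%R -> ball a e (rV_cons (t, v)) <->
  ball (a ord0 ord0) e t /\ ball (\row_j a ord0 (lift ord0 j) : 'rV[R]_n) e v.
Proof.
move=> e0; rewrite !ball_rVP//; split => [H|[H1 H2] j].
  split; first by have := H ord0; rewrite rV_cons_coord0.
  by move=> j; have := H (lift ord0 j); rewrite rV_cons_coordS mxE.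
case: (unliftP ord0 j) => [k ->|->]; last by rewrite rV_cons_coord0.
by have := H2 k; rewrite rV_cons_coordS mxE.
Qed.

Lemma measurable_ball_rV n (a : 'rV[R]_n) (e : R) :
  (0 < e)%R -> measurable (ball a e : set (borel_rV R n)).
Proof.
move=> e0.
rewrite (_ : ball a e =
    \bigcap_(i : 'I_n) (@rV_coord R n i @^-1` ball (a ord0 i) e)).
  apply: fin_bigcap_measurable; first exact: finite_finset.
  move=> i _; rewrite -[X in measurable X]setTI.
  by apply: measurable_rV_coord => //; exact: measurable_ball.
apply/seteqP; split => [x /(ball_rVP _ _ e0) H i _|x H]; first exact: H.
by apply/ball_rVP => // j; exact: H.
Qed.

(** Balls of the sup norm are cubes. Positivity and finiteness of their measure
are all that is used later. *)
Lemma borel_lebesgue_ball n (a : 'rV[R]_n) (e : R) :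
  (0 < e)%R -> borel_lebesgue R n (ball a e) = ((e *+ 2) ^+ n)%:E.
Proof.
move=> e0; elim: n a => [|n IH] a.
  rewrite /= /dirac indicE mem_set ?expr0//.
  by apply/ball_rVP => // -[].
rewrite /= /pushforward.
rewrite (_ : _ @^-1` _ = ball (a ord0 ord0) e `*`
   (ball (\row_j a ord0 (lift ord0 j) : 'rV[R]_n) e : set (borel_rV R n)));
  last first.
  by apply/seteqP; split => -[t v]; rewrite /preimage /= =>
    /(ball_rV_cons a t v e0).
rewrite product_measure2E; last 2 first.
  exact: measurable_ball.
  exact: measurable_ball_rV.
rewrite IH exprS EFinM; congr (_ * _).
exact: (lebesgue_measure_ball _ (ltW e0)).
Qed.

Lemma lebesgue_measure_reflection (x : R) (A : set (measurableTypeR R)) :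
  measurable A ->
  lebesgue_measure ((fun t => x - t)%R @^-1` A) = lebesgue_measure A.
Proof.
move=> mA.
pose refl : measurableTypeR R -> measurableTypeR R := (fun t => x - t)%R.
have mrefl : measurable_fun setT refl by exact: measurable_funB.
apply/esym; pose nu :=
  measure_function_pushforward__canonical__measure_function_Measure
    [the {measure set _ -> \bar R} of @lebesgue_measure R] mrefl.
apply: (@lebesgue_measure_unique R nu) => // _ [[a b]] _ <-.
rewrite /nu /= /pushforward.
rewrite (_ : _ @^-1` _ = `[(x - b)%R, (x - a)%R[%classic); last first.
  apply/seteqP; split => t;
    rewrite /refl /preimage /= !in_itv/= => /andP[h1 h2].
    by apply/andP; split; lra.
  by apply/andP; split; lra.
rewrite !lebesgue_measure_itv/= !lte_fin ltrD2l ltrN2.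
by case: ifP => // _; rewrite -!EFinB; congr EFin; ring.
Qed.

Lemma rV_consB n (x : borel_rV R n.+1) t (v : borel_rV R n) :
  (x - rV_cons (t, v))%R =
  rV_cons (x ord0 ord0 - t, (\row_j x ord0 (lift ord0 j)) - v)%R.
Proof.
apply/rowP => j; rewrite [LHS]mxE [X in (_ + X)%R]mxE.
by case: (unliftP ord0 j) => [k ->|->];
  rewrite ?rV_cons_coordS ?rV_cons_coord0 //= !mxE.
Qed.

(** By induction on the dimension: the sections of a reflected set are reflections
of sections, so the claim follows from the one-dimensional case and, by a change
of variables, from the induction hypothesis. *)
Lemma borel_lebesgue_reflection n (x : borel_rV R n) (A : set (borel_rV R n)) :
  measurable A ->
  borel_lebesgue R n ((fun y => x - y)%R @^-1` A) = borel_lebesgue R n A.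
Proof.
elim: n x A => [|n IH] x A mA.
  rewrite /= /dirac !indicE; congr ((_ : bool)%:R%:E).
  have x0 : (x - 0 = 0)%R by apply/rowP; case.
  by apply/idP/idP; rewrite !inE/= /preimage/= x0.
pose x' : borel_rV R n := \row_j x ord0 (lift ord0 j).
pose cA := @rV_cons R n @^-1` A.
have mcA : measurable cA.
  by rewrite -[X in measurable X]setTI; exact: measurable_rV_cons.
rewrite /= /pushforward /product_measure2.
pose f (v : borel_rV R n) := lebesgue_measure (ysection cA v).
have mf : measurable_fun setT f by exact: measurable_fun_ysection.
have mrefl := measurable_rV_sub x'.
transitivity (\int[borel_lebesgue R n]_v f (x' - v)%R).
  apply: eq_integral => v _ /=.
  rewrite -[RHS](@lebesgue_measure_reflection (x ord0 ord0)); last first.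
    exact: measurable_ysection.
  congr (lebesgue_measure _); apply/seteqP; split => t;
    by rewrite /ysection /preimage /= !inE /cA /preimage /= rV_consB.
transitivity (\int[pushforward (borel_lebesgue R n)
    (fun v : borel_rV R n => (x' - v)%R : borel_rV R n)]_v f v).
  rewrite (ge0_integral_pushforward mrefl _ measurableT mf).
    by rewrite preimage_setT.
  by move=> v _; exact: measure_ge0.
apply: eq_measure_integral => B mB _.
exact: IH.
Qed.

(** Every null set is contained in a Borel null set, so the invariance on Borel
sets is enough. *)
Lemma lebesgue_negligible_reflection n (x : 'rV[R]_n) (N : set 'rV[R]_n) :
  (leb R n).-negligible N ->
  (leb R n).-negligible ((fun y => x - y)%R @^-1` N).
Proof.
move=> [A [mA A0 NA]].
have Aoo : ((borel_lebesgue R n)^*%mu A < +oo)%E.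
  by rewrite [X in (X < _)%E]A0 ltry.
have [F [mF AF F0]] := borel_hull Aoo.
have mG : measurable ((fun y => x - y)%R @^-1` F : set (borel_rV R n)).
  by rewrite -[X in measurable X]setTI; exact: measurable_rV_sub.
exists ((fun y => x - y)%R @^-1` F); split.
- exact: measurable_caratheodory.
- rewrite /leb /= /completed_measure_extension measurable_mu_extE//.
  by rewrite borel_lebesgue_reflection// F0 -[RHS]A0.
- by move=> y /NA /AF.
Qed.

Lemma measurable_borel_leb n (A : set (borel_rV R n)) :
  measurable A -> (measurable : set (set (lebesgue_rV R n))) A.
Proof. exact: measurable_caratheodory. Qed.

Lemma leb_ball n (a : 'rV[R]_n) (e : R) : (0 < e)%R ->
  leb R n (ball a e) = ((e *+ 2) ^+ n)%:E.
Proof.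
move=> e0; rewrite /leb /= /completed_measure_extension measurable_mu_extE.
  exact: borel_lebesgue_ball.
exact: measurable_ball_rV.
Qed.

(** Balls of rational centre and radius 1/(k+1), indexed by codes in [nat] so that
the countable unions below are unions of sequences. *)
Definition rat_ball n (i : nat) : set 'rV[R]_n :=
  if @unpickle ('rV[rat]_n * nat)%type i is Some (q, k)
  then ball (map_mx ratr q : 'rV[R]_n) k.+1%:R^-1 else set0.

Lemma measurable_rat_ball n i : measurable (rat_ball i : set (borel_rV R n)).
Proof.
rewrite /rat_ball; case: unpickle => [[q k]|//].
by apply: measurable_ball_rV; rewrite invr_gt0.
Qed.

Lemma rat_ball_basis n (x : 'rV[R]_n) (e : R) : (0 < e)%R ->
  exists i, rat_ball i x /\ rat_ball i `<=` ball x e.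
Proof.
move=> e0.
have e20 : (0 < e / 2)%R by rewrite divr_gt0.
have [k _ /(_ k (leqnn _)) /= ke] := near_infty_natSinv_lt (PosNum e20).
pose s : R := k.+1%:R^-1%R; have s0 : (0 < s)%R by rewrite invr_gt0.
have dens (t : R) : exists q : rat, (`|ratr q - t| < s)%R.
  have [|q] := @rat_in_itvoo R (t - s)%R (t + s)%R; first by lra.
  by rewrite in_itv/= => /andP[h1 h2]; exists q; rewrite ltr_norml; lra.
have [q qP] := choice (fun j => dens (x ord0 j)).
pose c : 'rV[R]_n := map_mx ratr (\row_j q j).
have xq : ball c s x.
  by apply/ball_rVP => // j; rewrite !mxE /ball /=; exact: qP.
exists (pickle (\row_j q j, k)); rewrite /rat_ball pickleK; split => // y qy.
have -> : e = (e / 2 + e / 2)%R by lra.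
apply: (@ball_triangle _ _ c).
  by apply: ball_sym; apply: le_ball xq; exact: ltW.
by apply: le_ball qy; exact: ltW.
Qed.

Lemma measurable_open_rV n (U : set 'rV[R]_n) : open U ->
  measurable (U : set (borel_rV R n)).
Proof.
move=> oU.
rewrite (_ : U = \bigcup_(i in [set i | rat_ball i `<=` U]) rat_ball i).
  by apply: bigcup_measurable => i _; exact: measurable_rat_ball.
apply/seteqP; split => [x Ux|x [i /= + ix]]; last exact.
have /nbhs_ballP[e /= e0 eU] := open_nbhs_nbhs (conj oU Ux).
have [i [ix ie]] := rat_ball_basis x e0.
by exists i => //=; exact: subset_trans eU.
Qed.

(** The Lindelof argument: a point of N lies in a small rational ball that meets N
in a null set, and there are countably many rational balls. *)
Lemma negligible_local n (N : set 'rV[R]_n) :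
  (forall x, N x -> exists2 e : R, (0 < e)%R &
     (leb R n).-negligible (ball x e `&` N)) ->
  (leb R n).-negligible N.
Proof.
move=> Nloc.
pose F i := if pselect ((leb R n).-negligible (rat_ball i `&` N))
  then rat_ball i `&` N else set0.
have : (leb R n).-negligible (\bigcup_i F i).
  apply: negligible_bigcup => i; rewrite /F.
  by case: pselect => [h|h] /=; [exact: h|exact: negligible_set0].
apply: negligibleS => x Nx; have [e e0 Ne] := Nloc _ Nx.
have [i [ix ie]] := rat_ball_basis x e0.
exists i => //; rewrite /F; case: pselect => //= -[].
by apply: negligibleS Ne; exact: setSI.
Qed.

Lemma lebesgue_sigma_finite n : sigma_finite setT (leb R n).
Proof.
exists (fun k => ball (0%R : 'rV[R]_n) k.+1%:R).
  apply/seteqP; split => // x _.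
  exists (Num.truncn `|x|) => //; rewrite -ball_normE /= sub0r normrN.
  exact: truncnS_gt.
move=> k; split; last by rewrite leb_ball// ltry.
by apply: measurable_borel_leb; apply: measurable_ball_rV; exact: ltr0Sn.
Qed.

End lebesgue_rV.

#[global] Instance leb_ae_filter (R : realType) n :
  Filter (nbhs (almost_everywhere (leb R n))).
Proof. exact: ae_filter_ringOfSetsType. Qed.

(** * Functions constant at distance less than r *)

Section nonlocal_connectedness.
Variables (R : realType) (n : nat).
Implicit Types (x y z : 'rV[R]_n) (v : 'rV[R]_n -> R).

Lemma enorm_continuous : continuous (@enorm R n).
Proof.
move=> x; apply: (continuous_comp (g := @Num.sqrt R));
  last exact: sqrt_continuous.
apply: (@continuous_big _ _ +%R) => [|i _ y].
  exact: add_continuous.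
apply: (continuous_comp (g := fun t : R => t ^+ 2));
  last exact: exprn_continuous.
exact: coord_continuous.
Qed.

Lemma enormZ (t : R) x : 0 <= t -> enorm (t *: x) = t * enorm x.
Proof.
move=> t0; rewrite /enorm.
have -> : \sum_i (t *: x) ord0 i ^+ 2 = t ^+ 2 * \sum_i x ord0 i ^+ 2.
  by rewrite mulr_sumr; apply: eq_bigr => i _; rewrite mxE exprMn.
by rewrite sqrtrM ?sqr_ge0// sqrtr_sqr ger0_norm.
Qed.

Lemma enorm0 : enorm (0 : 'rV[R]_n) = 0.
Proof. by rewrite -(scale0r 0) enormZ// mul0r. Qed.

(** Near is meant for the sup norm, which defines the topology, whereas the
distance is Euclidean; continuity of the Euclidean norm reconciles the two. *)
Lemma enorm_lt_near r x y : enorm (x - y) < r ->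
  exists2 e : R, 0 < e &
    forall x' y', ball x e x' -> ball y e y' -> enorm (x' - y') < r.
Proof.
move=> xyr.
have := @enorm_continuous (x - y) _
  (open_nbhs_nbhs (conj (@open_lt R r) xyr)).
move=> /nbhs_ballP[e /= e0 He]; exists (e / 2); first by rewrite divr_gt0.
move=> x' y' xx' yy'; apply: He; move: xx' yy'.
rewrite -!ball_normE /= => xx' yy'.
rewrite (_ : _ - _ = (x - x') - (y - y')); last first.
  by rewrite !opprB addrACA [RHS]addrACA [- y - x']addrC.
apply: le_lt_trans (ler_normB _ _) _; lra.
Qed.

Lemma open_enorm_lt r (S : set 'rV[R]_n) :
  open [set z | exists2 w, S w & enorm (z - w) < r].
Proof.
rewrite openE => z /= [w Sw /enorm_lt_near [e e0 He]].
apply/nbhs_ballP; exists e => //= z' zz'; exists w => //.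
by apply: He => //; exact: ballxx.
Qed.

(** Balls have positive measure, hence they meet every set of full measure. *)
Lemma ae_ball_witness (P : 'rV[R]_n -> Prop) z (e : R) : 0 < e ->
  {ae leb R n, forall x, P x} -> exists2 x, ball z e x & P x.
Proof.
move=> e0 [N [mN N0 PN]].
apply: contrapT => nP; suff : (leb R n (ball z e) <= leb R n N)%E.
  by rewrite N0 leb_ball// lee_fin leNgt exprn_gt0// mulrn_wgt0.
apply: le_measure; rewrite ?inE//.
  by apply: measurable_borel_leb; exact: measurable_ball_rV.
move=> x zx; apply: PN => /= Px; apply: nP; by exists x.
Qed.

Section constant.
Variables (r : R) (Omega : set 'rV[R]_n) (c : 'rV[R]_n -> R).
Hypotheses (r_gt0 : 0 < r).
Hypothesis c_const : forall x y, Omega x -> Omega y ->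
  enorm (x - y) < r -> c x = c y.

(** The part of U where c takes a given value is open in U, as is the rest of U,
since both are unions of traces of open r-neighbourhoods. *)
Lemma connected_constant U : connected U -> U `<=` Omega ->
  forall x y, U x -> U y -> c x = c y.
Proof.
move=> cU UO x y Ux Uy.
pose B := U `&` [set z | c z = c x].
suff BU : B = U by have : U y by []; rewrite -{1}BU => -[].
apply: cU.
- by exists x.
- exists [set z | exists2 w, B w & enorm (z - w) < r].
    exact: open_enorm_lt.
  apply/seteqP; split => z [Uz].
    by move=> cz; split=> //; exists z; [split|rewrite subrr enorm0].
  move=> [w [Uw cw] zw]; split => //=.
  by rewrite -cw; apply: c_const => //; exact: UO.
- exists (~` [set z | exists2 w, (U `\` B) w & enorm (z - w) < r]).
    by apply: open_closedC; exact: open_enorm_lt.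
  apply/seteqP; split => z [Uz].
    move=> cz; split => // -[w [Uw nBw] zw]; apply: nBw; split => //=.
    by rewrite -cz; apply/esym/c_const => //; exact: UO.
  move=> H; split => //; apply: contrapT => ncz; apply: H.
  by exists z; [split => // -[]|rewrite subrr enorm0].
Qed.

(** The supremum defining the diameter is not attained on an open set: a pair of
points at distance at least r could be pulled slightly further apart inside
Omega. Hence the case of a closed bound on the diameter reduces to pairs at
distance less than r. *)
Lemma open_diam_lt : open Omega -> (diam Omega <= r%:E)%E ->
  forall x y, Omega x -> Omega y -> enorm (x - y) < r.
Proof.
move=> oO dO x y Ox Oy.
have le_r x' y' : Omega x' -> Omega y' -> enorm (x' - y') <= r.
  move=> Ox' Oy'; rewrite -lee_fin; apply: le_trans dO.
  by apply: ereal_sup_ubound; exists (x', y').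
rewrite ltNge; apply/negP => rxy.
(* The point g t moves away from x on the line through x and y. *)
pose g (t : R) := y - t *: (x - y).
have gc : g t @[t --> (0 : R)] --> g 0.
  apply: cvgB; first exact: cvg_cst.
  by apply: cvgZr_tmp; exact: cvg_id.
have : nbhs (0 : R) (g @^-1` Omega).
  apply: gc; apply: open_nbhs_nbhs; split => //.
  by rewrite /g scale0r subr0.
move=> /nbhs_ballP[e /= e0 He].
have e20 : 0 < e / 2 by rewrite divr_gt0.
have Og : Omega (g (e / 2)).
  by apply: He; rewrite /ball /= sub0r normrN gtr0_norm//; lra.
have := le_r _ _ Ox Og.
rewrite (_ : x - g (e / 2) = (1 + e / 2) *: (x - y)); last first.
  by rewrite /g opprB [RHS]scalerDl scale1r addrA addrAC.
have s0 : 0 <= 1 + e / 2 by lra.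
rewrite enormZ// leNgt => /negP; apply.
have : 0 < e / 2 * r by rewrite mulr_gt0.
have : 0 <= (1 + e / 2) * (enorm (x - y) - r).
  by rewrite mulr_ge0 ?subr_ge0//; lra.
lra.
Qed.

(** Along a chain of connected pieces, the constants of two consecutive pieces
agree because some pair of points, one in each piece, is at distance less than
rho. *)
Lemma nonlocally_connected_constant rho : rho < r -> open Omega ->
  (diam Omega <= r%:E)%E \/ rho_connected rho Omega ->
  forall x y, Omega x -> Omega y -> c x = c y.
Proof.
move=> rho_r oO [dO|[m [U [m0 OU ocU dU]]]] x y Ox Oy.
  by apply: c_const => //; exact: open_diam_lt.
have UO i : (i < m)%N -> U i `<=` Omega.
  by move=> im; rewrite OU; exact: bigcup_sup.
suff H j i : (i <= j)%N -> (j < m)%N ->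
    forall x' y', U i x' -> U j y' -> c x' = c y'.
  move: Ox Oy; rewrite OU => -[i im Ux] [j jm Uy].
  have [ij|/ltnW ji] := leqP i j; first exact: (H j i).
  exact/esym/(H i j).
elim: j i => [|j IH] i ij jm x' y' Ux' Uy'.
  move: ij Ux'; rewrite leqn0 => /eqP -> Ux'.
  exact: connected_constant (ocU _ jm).2 (UO _ jm) _ _ Ux' Uy'.
move: ij; rewrite leq_eqVlt => /orP[/eqP ij|ij].
  rewrite ij in Ux'.
  exact: connected_constant (ocU _ jm).2 (UO _ jm) _ _ Ux' Uy'.
have jm' : (j < m)%N by exact: ltnW.
have [_ [[a b] [/= Ua Ub] <-] ab] := ereal_inf_lt (dU _ jm).
rewrite (connected_constant (ocU _ jm).2 (UO _ jm) Uy' Ub).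
rewrite (IH i ij jm' _ _ Ux' Ua).
apply: c_const; [exact: UO Ua|exact: UO Ub|].
by apply: lt_trans rho_r; rewrite -lte_fin.
Qed.

End constant.

(** The values of v only matter almost everywhere, so v is first replaced by a
function c defined at every point: c z is the value of v at one generic point of
a small ball around z, which v takes almost everywhere on that ball. Choosing
generic points near x and then near y shows that c x and c y agree whenever x
and y are at distance less than r, so that c is constant; then v equals this
constant near every point up to a null set. *)
Lemma ae_constant (r rho : R) (Omega : set 'rV[R]_n) v : 0 < r -> rho < r ->
  open Omega -> (diam Omega <= r%:E)%E \/ rho_connected rho Omega ->
  {ae leb R n, forall x, Omega x ->
    {ae leb R n, forall y, Omega y -> enorm (x - y) < r -> v x = v y}} ->
  exists k : R, {ae leb R n, forall x, Omega x -> v x = k}.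
Proof.
move=> r0 rho_r oO hO vP.
have /choice[c cP] (z : 'rV[R]_n) : exists k : R, Omega z ->
    exists2 e : R, 0 < e & {ae leb R n, forall y, ball z e y -> v y = k}.
  have [Oz|nOz] := pselect (Omega z); last by exists 0.
  have zr : enorm (z - z) < r by rewrite subrr enorm0.
  have [e1 e10 He1] := enorm_lt_near zr.
  have /nbhs_ballP[e2 /= e20 He2] := open_nbhs_nbhs (conj oO Oz).
  pose e := Num.min e1 e2; have e0 : 0 < e by rewrite lt_min e10.
  have [x zx xP] := ae_ball_witness z e0 vP.
  have sub1 y : ball z e y -> ball z e1 y.
    by apply: le_ball; rewrite ge_min lexx.
  have sub2 y : ball z e y -> ball z e2 y.
    by apply: le_ball; rewrite ge_min lexx orbT.
  exists (v x) => _; exists e => //.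
  have := xP (He2 _ (sub2 _ zx)).
  apply: filterS => y yP zy; apply/esym/yP; first exact/He2/sub2.
  by apply: He1; exact: sub1.
have c_const x y : Omega x -> Omega y -> enorm (x - y) < r -> c x = c y.
  move=> Ox Oy xy.
  have [e e0 He] := enorm_lt_near xy.
  have [ex ex0 Hx] := cP _ Ox; have [ey ey0 Hy] := cP _ Oy.
  have /nbhs_ballP[fx /= fx0 Hfx] := open_nbhs_nbhs (conj oO Ox).
  have /nbhs_ballP[fy /= fy0 Hfy] := open_nbhs_nbhs (conj oO Oy).
  pose dx := Num.min e (Num.min ex fx); pose dy := Num.min e (Num.min ey fy).
  have dx0 : 0 < dx by rewrite !lt_min e0 ex0.
  have dy0 : 0 < dy by rewrite !lt_min e0 ey0.
  have [x' xx' [xP cx']] := ae_ball_witness x dx0 (filterI vP Hx).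
  have bx (a : R) : dx <= a -> ball x a x' by move=> h; exact: le_ball xx'.
  have Ox' : Omega x' by apply/Hfx/bx; rewrite /dx !ge_min lexx !orbT.
  have [y' yy' [yP cy']] := ae_ball_witness y dy0 (filterI (xP Ox') Hy).
  have by' (a : R) : dy <= a -> ball y a y' by move=> h; exact: le_ball yy'.
  rewrite -cx'; last by apply/bx; rewrite /dx !ge_min lexx !orbT.
  rewrite -cy'; last by apply/by'; rewrite /dy !ge_min lexx !orbT.
  apply: yP; first by apply/Hfy/by'; rewrite /dy !ge_min lexx !orbT.
  apply: He; [apply: bx|apply: by']; by rewrite ge_min lexx.
have [[z Oz]|nO] := pselect (exists z, Omega z); last first.
  by exists 0; apply: aeW => x Ox; case: nO; exists x.
exists (c z); apply: negligible_local => x /= /not_implyP[Ox _].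
have [e e0 He] := cP _ Ox; exists e => //.
apply: negligibleS He => y [xy /= /not_implyP[Oy yz]] /(_ xy) vy.
apply: yz; rewrite vy.
exact: (nonlocally_connected_constant r0 c_const rho_r oO hO).
Qed.

End nonlocal_connectedness.

(** * Integrals of p-th powers on a set of finite measure *)

Section power_integrals.
Context d (T : measurableType d) (R : realType).
Variables (mu : {measure set T -> \bar R}) (D : set T) (p m : R).
Hypotheses (mD : measurable D) (mu_D : mu D = m%:E) (p_ge1 : 1 <= p).
Implicit Types f g w v : T -> R.
Local Notation pow_int f := (\int[mu]_(x in D) (`|f x| `^ p)%:E)%E.

Let p_ge0 : 0 <= p. Proof. exact: le_trans p_ge1. Qed.

Lemma measurable_norm_powR f :
  measurable_fun D f -> measurable_fun D (fun x => `|f x| `^ p).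
Proof.
move=> mf; have mnf : measurable_fun D (fun x => `|f x|).
  exact: measurableT_comp.
have := measurableT_comp (@measurable_powR R p) mnf.
by apply: eq_measurable_fun => x _.
Qed.

Let measurable_pow f :
  measurable_fun D f -> measurable_fun D (fun x => (`|f x| `^ p)%:E).
Proof. by move=> mf; exact/measurable_EFinP/measurable_norm_powR. Qed.

Lemma pow_int_ge0 f : (0 <= pow_int f)%E.
Proof. exact: integral_ge0. Qed.

Lemma integral_affine_pow f (k c : R) : measurable_fun D f ->
  0 <= k -> 0 <= c ->
  (\int[mu]_(x in D) (k%:E * (`|f x| `^ p)%:E + c%:E) =
   k%:E * pow_int f + (c * m)%:E)%E.
Proof.
move=> mf k0 c0; rewrite ge0_integralD//; last 2 first.
- by move=> x _; rewrite mule_ge0.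
- exact/measurable_funeM/measurable_pow.
rewrite ge0_integralZl// ?integral_cst// ?mu_D ?EFinM//.
exact: measurable_pow.
Qed.

Lemma pow_int_subr_lty f (a : R) : measurable_fun D f ->
  (pow_int f < +oo)%E -> (pow_int (fun x => f x - a) < +oo)%E.
Proof.
move=> mf foo.
apply: (@le_lt_trans _ _ (\int[mu]_(x in D)
    ((3 `^ p)%:E * (`|f x| `^ p)%:E + (3 `^ p * (`|a| `^ p))%:E))%E).
  apply: nonneg_le_integral => [//|x Dx]; rewrite -EFinM -EFinD lee_fin -mulrDr.
  have := powR_add3_le p_ge0 (normr_ge0 (f x)) (normr_ge0 a) (lexx 0).
  rewrite addr0; have [p0|p0] := eqVneq p 0.
    by have := p_ge1; rewrite p0 ler10.
  rewrite powR0// addr0; apply: le_trans.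
  by apply: ge0_ler_powR; rewrite ?nnegrE ?addr_ge0// ler_normB.
rewrite integral_affine_pow ?mulr_ge0 ?powR_ge0//.
by rewrite lte_add_pinfty ?ltry// lte_mul_pinfty// lee_fin powR_ge0.
Qed.

Lemma pow_int_scale f (k : R) : measurable_fun D f -> 0 <= k ->
  pow_int (fun x => k * f x) = ((k `^ p)%:E * pow_int f)%E.
Proof.
move=> mf k0; rewrite -ge0_integralZl//; [|exact: measurable_pow|].
  by apply: eq_integral => x _; rewrite normrM (ger0_norm k0) powRM// EFinM.
by rewrite lee_fin powR_ge0.
Qed.

Lemma pow_int_ae_eq f g : measurable_fun D f -> measurable_fun D g ->
  {ae mu, forall x, D x -> f x = g x} -> pow_int f = pow_int g.
Proof.
move=> mf mg fg; apply: ge0_ae_eq_integral => //; try exact: measurable_pow.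
have F := ae_filter_ringOfSetsType mu.
by apply: filterS fg => x fgx Dx; rewrite fgx.
Qed.

(** On a set of finite measure, by t <= 1 + t ^ p. *)
Lemma pow_int_integrable f : measurable_fun D f -> (pow_int f < +oo)%E ->
  mu.-integrable D (EFin \o f).
Proof.
move=> mf foo; apply/integrableP; split; first exact/measurable_EFinP.
apply: (@le_lt_trans _ _ (\int[mu]_(x in D)
    (1%:E * (`|f x| `^ p)%:E + 1%:E))%E).
  apply: nonneg_le_integral => x Dx //=.
  by rewrite mul1e -EFinD lee_fin addrC le_1D_powR.
by rewrite integral_affine_pow// mul1e lte_add_pinfty ?ltry.
Qed.

Let cst_int (a : R) : mu.-integrable D (EFin \o cst a).
Proof.
apply/integrableP; split; first exact/measurable_EFinP.
by rewrite (integral_cst mu mD `|a|%:E) mu_D ltry.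
Qed.

Lemma integral_sub_mean f : 0 < m -> measurable_fun D f ->
  (pow_int f < +oo)%E ->
  (\int[mu]_(x in D) (f x - m^-1 * \int[mu]_(x in D) f x)%:E = 0)%E.
Proof.
move=> m0 mf foo; have fint := pow_int_integrable mf foo.
set a := m^-1 * _.
have aint : mu.-integrable D (EFin \o cst a) by exact: cst_int.
have := integralB_EFin mD fint aint.
under eq_integral do rewrite -EFinB.
move=> ->; rewrite (integral_cst mu mD a%:E) mu_D -EFinM /a mulrAC.
rewrite mulVf ?gt_eqF// mul1r.
rewrite /Rintegral fineK ?subee//; first exact: integrable_fin_num.
exact: integrable_fin_num.
Qed.

(** Integrate L * |w - c| <= 1 + (L * |w - c|) ^ p over D, where |c| * m is at most
the integral of |w - c| because w has mean zero. The free parameter L replaces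
the Hoelder inequality: if G tends to 0, then |c| is at most 1 / L for every L. *)
Lemma mean_zero_cst_bound w (c L G : R) : measurable_fun D w ->
  (\int[mu]_(x in D) (w x)%:E = 0)%E -> (pow_int w < +oo)%E -> 0 <= L ->
  pow_int (fun x => w x - c) = G%:E ->
  L * `|c| * m <= m + L `^ p * G.
Proof.
move=> mw w0 woo L0 wG; have wint := pow_int_integrable mw woo.
have cint : mu.-integrable D (EFin \o cst c) by exact: cst_int.
have mwc : measurable_fun D (fun x => w x - c) by exact: measurable_funB.
have := integralB_EFin mD wint cint.
rewrite w0 (integral_cst mu mD c%:E) mu_D add0e => wcE.
have : (`|\int[mu]_(x in D) (w x - c)%:E| <=
        \int[mu]_(x in D) `|(w x - c)%:E|)%E.
  by apply: le_abse_integral => //; exact/measurable_EFinP.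
under eq_integral do rewrite EFinB.
rewrite wcE abseN -EFinM abse_EFin => H.
have mawc : measurable_fun D (fun x => `|(w x - c)%:E|)%E.
  by apply/measurable_EFinP; exact: measurableT_comp.
rewrite -lee_fin -mulrA EFinM.
apply: (@le_trans _ _ (\int[mu]_(x in D) (L%:E * `|(w x - c)%:E|))%E).
  rewrite ge0_integralZl//; apply: lee_wpmul2l; first by rewrite lee_fin.
  by apply: le_trans H; rewrite lee_fin normrM ler_wpM2l// ler_norm.
apply: (@le_trans _ _ (\int[mu]_(x in D)
    ((L `^ p)%:E * (`|w x - c| `^ p)%:E + 1%:E))%E).
  apply: nonneg_le_integral => x Dx; first by rewrite mule_ge0 ?lee_fin.
  rewrite abse_EFin -!EFinM -EFinD lee_fin [leRHS]addrC -powRM//.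
  by apply: le_1D_powR => //; exact: mulr_ge0.
by rewrite integral_affine_pow ?powR_ge0// wG mul1r -EFinM -EFinD addrC.
Qed.

End power_integrals.

(** * Energies and indicator kernels *)

Section truncated_energy.
Variables (R : realType) (n : nat) (p : R) (Omega : set 'rV[R]_n).
Hypotheses (p_ge1 : 1 <= p) (Omega_open : open Omega).
Implicit Types (B : set 'rV[R]_n) (u v w nu : 'rV[R]_n -> R).
Local Notation mu := (leb R n).
Local Notation mfun u := (@measurable_fun _ _ (lebesgue_rV R n) R Omega u).
Local Notation pow_int u := (\int[mu]_(x in Omega) (`|u x| `^ p)%:E)%E.

Let p_gt0 : 0 < p. Proof. exact: lt_le_trans p_ge1. Qed.

Lemma measurable_leb_open : measurable (Omega : set (lebesgue_rV R n)).
Proof. by apply: measurable_borel_leb; exact: measurable_open_rV. Qed.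

Local Notation mOmega := measurable_leb_open.

(** The kernel is only known to be nonnegative off the origin; on the diagonal the
first factor vanishes. *)
Lemma energy_integrand_ge0 nu u x y : (forall h, h != 0 -> 0 <= nu h) ->
  0 <= `|u x - u y| `^ p * nu (x - y).
Proof.
move=> nu0; have [->|xy] := eqVneq x y.
  by rewrite subrr normr0 powR0 ?mul0r// gt_eqF.
by rewrite mulr_ge0 ?powR_ge0// nu0// subr_eq0.
Qed.

Lemma energy_ge0 nu u : (forall h, h != 0 -> 0 <= nu h) ->
  (0 <= energy p Omega nu u)%E.
Proof.
move=> nu0; apply: integral_ge0 => x _; apply: integral_ge0 => y _.
by rewrite lee_fin energy_integrand_ge0.
Qed.

(** Covers both the scaling of the function and the comparison of kernels. *)
Lemma le_energy (k : R) nu1 nu2 u1 u2 : 0 < k ->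
  (forall h, h != 0 -> 0 <= nu1 h) -> (forall h, h != 0 -> 0 <= nu2 h) ->
  (forall x y, Omega x -> Omega y -> x != y ->
     `|u1 x - u1 y| `^ p * nu1 (x - y) <=
     k * (`|u2 x - u2 y| `^ p * nu2 (x - y))) ->
  (energy p Omega nu1 u1 <= k%:E * energy p Omega nu2 u2)%E.
Proof.
move=> k0 nu10 nu20 le12.
apply: le_trans (nonneg_integralZl_le _ k0 _); last first.
  by move=> x _; apply: integral_ge0 => y _; rewrite lee_fin energy_integrand_ge0.
apply: nonneg_le_integral => x Ox.
  by apply: integral_ge0 => y _; rewrite lee_fin energy_integrand_ge0.
apply: le_trans (nonneg_integralZl_le _ k0 _); last first.
  by move=> y _; rewrite lee_fin energy_integrand_ge0.
apply: nonneg_le_integral => y Oy; first by rewrite lee_fin energy_integrand_ge0.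
rewrite -EFinM lee_fin; have [->|xy] := eqVneq x y; last exact: le12.
by rewrite !subrr normr0 powR0 ?mul0r ?mulr0// gt_eqF.
Qed.

Lemma measurable_rV_diff : measurable_fun setT
  (fun xy : lebesgue_rV R n * lebesgue_rV R n => (xy.1 - xy.2 : borel_rV R n)).
Proof.
apply: measurable_to_borel_rV => i.
have mc : @measurable_fun _ _ (lebesgue_rV R n) R setT (@rV_coord R n i).
  move=> _ Y mY; apply: measurable_borel_leb.
  exact: measurable_rV_coord.
rewrite (_ : _ \o _ = (fun xy => rV_coord i xy.1 - rV_coord i xy.2)).
  by apply: measurable_funB; apply: measurableT_comp mc _.
by apply/funext => y; rewrite /= /rV_coord !mxE.
Qed.

Section indicator_kernel.
Variable B : set 'rV[R]_n.
Hypothesis mB : measurable (B : set (borel_rV R n)).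

(** The set B has to be Borel: the difference map is measurable from the product of
the Lebesgue sigma-algebras to the Borel one, not to the Lebesgue one. *)
Lemma measurable_indicator_kernel u : mfun u ->
  measurable_fun setT (fun xy : lebesgue_rV R n * lebesgue_rV R n =>
    (`|(u \_ Omega) xy.1 - (u \_ Omega) xy.2| `^ p * \1_B (xy.1 - xy.2))%:E).
Proof.
move=> mu_.
have mu' : @measurable_fun _ _ (lebesgue_rV R n) R setT (u \_ Omega).
  by apply/(measurable_restrictT _ mOmega).1.
apply/measurable_EFinP; apply: measurable_funM.
  apply: (measurableT_comp (f := fun t : R => t `^ p)) => //.
  apply: measurableT_comp => //.
  by apply: measurable_funB; apply: measurableT_comp mu' _.
by apply: measurableT_comp measurable_rV_diff; exact: measurable_indic.
Qed.

Lemma measurable_indicator_section u x : mfun u -> Omega x ->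
  @measurable_fun _ _ (lebesgue_rV R n) _ Omega
    (fun y => (`|u x - u y| `^ p * \1_B (x - y))%:E).
Proof.
move=> mu_ Ox.
have := measurableT_comp (measurable_indicator_kernel mu_)
  (pair1_measurable (x : lebesgue_rV R n)).
move=> /(measurable_funTS (D := Omega : set (lebesgue_rV R n))).
apply: eq_measurable_fun => y Oy; rewrite /= !patchE.
by rewrite Oy mem_set.
Qed.

Lemma measurable_indicator_inner u : mfun u ->
  @measurable_fun _ _ (lebesgue_rV R n) _ Omega
    (fun x => \int[mu]_(y in Omega) (`|u x - u y| `^ p * \1_B (x - y))%:E)%E.
Proof.
move=> mu_.
pose K (xy : lebesgue_rV R n * lebesgue_rV R n) : \bar R :=
  ((`|(u \_ Omega) xy.1 - (u \_ Omega) xy.2| `^ p * \1_B (xy.1 - xy.2))%:E *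
   (\1_Omega xy.2)%:E)%E.
have mK : measurable_fun setT K.
  apply: emeasurable_funM; first exact: measurable_indicator_kernel.
  apply/measurable_EFinP; apply: (measurableT_comp _ measurable_snd).
  by apply: measurable_indic; exact: mOmega.
have K0 xy : (0 <= K xy)%E.
  by rewrite mule_ge0 ?lee_fin// mulr_ge0 ?powR_ge0.
have := measurable_section_integral (@lebesgue_sigma_finite R n) mK K0.
move=> /(measurable_funTS (D := Omega : set (lebesgue_rV R n))).
apply: eq_measurable_fun => x Ox; rewrite [RHS]integral_mkcond.
apply: eq_integral => y _; rewrite /K /= !patchE Ox.
by rewrite [\1_Omega y]indicE; case: (y \in Omega); rewrite ?mule1 ?mule0.
Qed.

Lemma energy_indicator_eq0 v : mfun v ->
  energy p Omega \1_B v = 0%E ->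
  {ae mu, forall x, Omega x ->
    {ae mu, forall y, Omega y -> B (x - y) -> v x = v y}}.
Proof.
move=> mv E0.
have /(ae_eq_integral_abs mu mOmega (measurable_indicator_inner mv)) :
    (\int[mu]_(x in Omega)
      `|\int[mu]_(y in Omega) (`|v x - v y| `^ p * \1_B (x - y))%:E|)%E = 0%E.
  rewrite -[RHS]E0; apply: eq_integral => x _; rewrite gee0_abs//.
  by apply: integral_ge0 => y _; rewrite lee_fin energy_integrand_ge0.
apply: filterS => x Hx Ox; have {Hx} Ex0 := Hx Ox.
have /(ae_eq_integral_abs mu mOmega (measurable_indicator_section mv Ox)) :
    (\int[mu]_(y in Omega) `|(`|v x - v y| `^ p * \1_B (x - y))%:E|)%E = 0%E.
  by rewrite -[RHS]Ex0; apply: eq_integral => y _; rewrite gee0_abs.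
apply: filterS => y Hy Oy Bxy.
have [/eqP] := Hy Oy; rewrite indicE mem_set// mulr1 => /eqP/powR_eq0_eq0/eqP.
by rewrite normr_eq0 subr_eq0 => /eqP.
Qed.

(** Replacing v by w costs two L^p distances, one for each variable. As the
indicator is bounded, each of them is paid once for every point of Omega, which
yields the factor m. *)
Lemma energy_indicator_le v w (m G : R) : mfun v -> mfun w ->
  mu Omega = m%:E -> pow_int (v \- w) = G%:E ->
  (energy p Omega \1_B v <= (3 `^ p)%:E *
    ((m * G *+ 2)%:E + energy p Omega \1_B w))%E.
Proof.
move=> mv mw Om OG.
pose g x : \bar R := (`|(v \- w) x| `^ p)%:E.
have mg : @measurable_fun _ _ (lebesgue_rV R n) _ Omega g.
  exact/measurable_EFinP/measurable_norm_powR/measurable_funB.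
have g0 x : (0 <= g x)%E by rewrite lee_fin powR_ge0.
have m0 : 0 <= m by rewrite -lee_fin -Om.
have G0 : 0 <= G by rewrite -lee_fin -OG; exact: integral_ge0.
have k0 : 0 < 3 `^ p :> R by rewrite powR_gt0.
pose s x y : \bar R := (`|w x - w y| `^ p * \1_B (x - y))%:E.
have s0 x y : (0 <= s x y)%E by rewrite lee_fin energy_integrand_ge0.
pose e x := (\int[mu]_(y in Omega) s x y)%E.
have e0 x : (0 <= e x)%E by exact: integral_ge0.
have me : @measurable_fun _ _ (lebesgue_rV R n) _ Omega e.
  exact: measurable_indicator_inner.
have -> : ((m * G *+ 2)%:E + energy p Omega \1_B w =
    \int[mu]_(x in Omega) (m%:E * g x + e x + G%:E))%E.
  rewrite (ge0_integral_affine mu mOmega mg me g0 e0 m0 G0) Om.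
  rewrite [X in (_ * X + _)%E]OG -!EFinM addeAC -EFinD.
  by congr (_ + _)%E; congr EFin; ring.
apply: le_trans (nonneg_integralZl_le _ k0 _); last first.
  move=> x _; apply: adde_ge0 => //; apply: adde_ge0 => //.
  by apply: mule_ge0 => //; rewrite lee_fin.
apply: nonneg_le_integral => x Ox.
  by apply: integral_ge0 => y _; rewrite lee_fin energy_integrand_ge0.
(* The factor 1 gives the integrand the shape of [ge0_integral_affine]. *)
have -> : (m%:E * g x + e x + G%:E = \int[mu]_(y in Omega)
    (1%:E * g y + s x y + (`|(v \- w) x| `^ p)%:E))%E.
  have ms := measurable_indicator_section mw Ox.
  rewrite (ge0_integral_affine mu mOmega mg ms g0 (s0 x) ler01 (powR_ge0 _ _)).
  rewrite Om [X in (_ = _ * X + _ + _)%E]OG mul1e -/(g x) -/(e x).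
  rewrite addeC addeA [RHS]addeAC [(m%:E * _)%E]muleC.
  by congr (_ + _)%E; rewrite addeC.
apply: le_trans (nonneg_integralZl_le _ k0 _); last first.
  move=> y _; apply: adde_ge0; last by rewrite lee_fin powR_ge0.
  by apply: adde_ge0 => //; rewrite mul1e.
apply: nonneg_le_integral => y Oy; first by rewrite lee_fin energy_integrand_ge0.
rewrite /g /s mul1e -!EFinD -EFinM lee_fin.
rewrite indicE; case: (_ \in B); last first.
  by rewrite !mulr0 addr0 mulr_ge0 ?addr_ge0 ?powR_ge0.
rewrite !mulr1; apply: le_trans (powR_add3_le (ltW p_gt0) _ _ _) => //.
apply: ge0_ler_powR; rewrite ?nnegrE ?addr_ge0// ?(ltW p_gt0)//=.
rewrite [leLHS](_ : _ = `|- (v y - w y) + (w x - w y) + (v x - w x)|).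
  by do 2 (apply: le_trans (ler_normD _ _) _; rewrite ?lerD2r ?normrN).
by congr `|_|; ring.
Qed.

End indicator_kernel.
End truncated_energy.

(** * Exhausting the set where the kernel is positive *)

Section positive_kernel.
Variables (R : realType) (n : nat).
Implicit Types (h x y : 'rV[R]_n) (nu : 'rV[R]_n -> R).

Lemma ler_coord_enorm h i : `|h ord0 i| <= enorm h.
Proof.
rewrite -sqrtr_sqr; apply: ler_wsqrtr.
by rewrite (bigD1 i)//= lerDl sumr_ge0// => j _; exact: sqr_ge0.
Qed.

Lemma enorm_lt_ball (r : R) h : 0 < r -> enorm h < r -> ball 0 r h.
Proof.
move=> r0 hr; apply/ball_rVP => // j.
rewrite /ball /= mxE sub0r normrN; apply: le_lt_trans hr.
exact: ler_coord_enorm.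
Qed.

(** The sets where nu is at least 1/(k+1) exhaust almost all of the ball of radius
r, and the part of each of them in this ball contains a Borel set of full
measure. The exceptional null set is then carried to differences x - y, for
fixed x, by reflection. *)
Lemma positive_kernel_cover nu (r : R) : 0 < r ->
  @measurable_fun _ _ (lebesgue_rV R n) R (~` [set (0 : 'rV[R]_n)]) nu ->
  {ae leb R n, forall h, enorm h < r -> 0 < nu h} ->
  exists B : nat -> set 'rV[R]_n,
  [/\ forall k, measurable (B k : set (borel_rV R n)),
      forall k h, B k h -> h != 0 /\ k.+1%:R^-1 <= nu h &
      forall x, {ae leb R n, forall y, enorm (x - y) < r -> x != y ->
        exists k, B k (x - y)}].
Proof.
move=> r0 mnu nu_pos.
pose K : set 'rV[R]_n := ball 0 r.
have mK : measurable (K : set (borel_rV R n)) by exact: measurable_ball_rV.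
have Koo : (borel_lebesgue R n K < +oo)%E by rewrite borel_lebesgue_ball// ltry.
pose E k := K `&` (~` [set (0 : 'rV[R]_n)] `&` nu @^-1` `[k.+1%:R^-1, +oo[).
have mN0 : measurable (~` [set (0 : 'rV[R]_n)] : set (lebesgue_rV R n)).
  apply: measurable_borel_leb; apply: measurable_open_rV.
  apply: closed_openC.
  exact/accessible_closed_set1/hausdorff_accessible/norm_hausdorff.
have mE k : measurable (E k : set (lebesgue_rV R n)).
  apply: measurableI; first exact: measurable_borel_leb.
  by apply: mnu => //; exact: measurable_itv.
have /choice[B BP] k := borel_inner_set mK Koo (mE k) (@subIsetl _ _ _).
exists B; split=> [k|k h|x].
- by have [] := BP k.
- have [_ + _] := BP k => /[apply] -[_ [/eqP h0]].
  by rewrite /= in_itv/= andbT.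
have EBneg k : (leb R n).-negligible (E k `\` B k) by have [] := BP k.
have := negligible_bigcup EBneg.
move=> /(negligibleU nu_pos)/(lebesgue_negligible_reflection x).
apply: negligibleS => y /= /not_implyP[xyr /not_implyP[xy nB]].
have [nuxy|nuxy] := pselect (0 < nu (x - y)); last first.
  by left => /= /(_ xyr).
right.
have [k _ /(_ k (leqnn _)) /= knu] := near_infty_natSinv_lt (PosNum nuxy).
exists k => //; split; last by move=> Bk; apply: nB; exists k.
split; first exact: enorm_lt_ball.
split; last by rewrite /= in_itv/= andbT ltW.
by move=> /eqP; rewrite subr_eq0; exact/negP.
Qed.

End positive_kernel.

(** * The Poincare inequality *)

Section poincare.
Variables (R : realType) (n : nat) (p : R) (Omega : set 'rV[R]_n)
  (nu : 'rV[R]_n -> R).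
Hypotheses (p_ge1 : 1 <= p) (Omega_open : open Omega)
  (Omega_bounded : bounded_set Omega).
Hypothesis nu_ge0 : forall h : 'rV[R]_n, h != 0 -> 0 <= nu h.
Implicit Types (u v w : 'rV[R]_n -> R).
Local Notation mu := (leb R n).
Local Notation mfun u := (@measurable_fun _ _ (lebesgue_rV R n) R Omega u).
Local Notation pow_int u := (\int[mu]_(x in Omega) (`|u x| `^ p)%:E)%E.

Let p_gt0 : 0 < p. Proof. exact: lt_le_trans p_ge1. Qed.
Let mOmega := measurable_leb_open Omega_open.

Lemma leb_bounded_open : Omega !=set0 ->
  exists2 m : R, 0 < m & mu Omega = m%:E.
Proof.
move=> [z Oz].
have Ooo : (mu Omega < +oo)%E.
  have [M [_ /(_ (M + 1)) H]] := Omega_bounded.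
  have {}H x : Omega x -> `|x| <= M + 1 by apply: H; rewrite ltrDl.
  pose b := `|M + 1| + 1; have b0 : 0 < b by rewrite ltr_wpDl.
  apply: (@le_lt_trans _ _ (mu (ball (0 : 'rV[R]_n) b))).
    apply: le_measure; rewrite ?inE//.
      by apply: measurable_borel_leb; exact: measurable_ball_rV.
    move=> x /H xM; rewrite -ball_normE /= sub0r normrN.
    by apply: le_lt_trans xM _; rewrite /b ltr_pwDr// ler_norm.
  by rewrite leb_ball// ltry.
have /nbhs_ballP[e /= e0 eO] := open_nbhs_nbhs (conj Omega_open Oz).
have Opos : (0 < mu Omega)%E.
  apply: (@lt_le_trans _ _ (mu (ball z e))).
    by rewrite leb_ball// lte_fin exprn_gt0// mulrn_wgt0.
  apply: le_measure; rewrite ?inE//.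
  by apply: measurable_borel_leb; exact: measurable_ball_rV.
exists (fine (mu Omega)); first by rewrite fine_gt0// Opos.
by rewrite fineK// ge0_fin_numE.
Qed.

Lemma Lp_norm_powE u : (Lp_norm p Omega u `^ p)%E = pow_int u.
Proof.
rewrite /Lp_norm -poweRrM mulVf ?gt_eqF// poweRe1//.
exact: pow_int_ge0.
Qed.

Lemma in_LpP u : in_Lp p Omega u <-> mfun u /\ (pow_int u < +oo)%E.
Proof.
split => -[mu_ uoo]; split => //.
  by rewrite -Lp_norm_powE; exact: poweR_lty.
exact: poweR_lty.
Qed.

(** Subtract the mean and divide by the L^p norm; the energy ignores the former
and is homogeneous of degree p. *)
Lemma normalized_counterexample (C : R) u : Omega !=set0 -> 0 < C ->
  in_Lp p Omega u ->
  ~ (Lp_norm p Omega (fun x => u x - average Omega u)%R `^ p <=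
     C%:E * energy p Omega nu u)%E ->
  exists w, [/\ mfun w, pow_int w = 1%E,
    (\int[mu]_(x in Omega) (w x)%:E = 0)%E &
    (energy p Omega nu w <= C^-1%:E)%E].
Proof.
move=> O0 C0 /in_LpP[mu_ uoo]; rewrite Lp_norm_powE => /negP; rewrite -ltNge.
have [m m0 Om] := leb_bounded_open O0.
pose a := average Omega u; pose g x := u x - a.
have mg : mfun g by exact: measurable_funB.
have goo : (pow_int g < +oo)%E.
  exact: (pow_int_subr_lty mOmega Om p_ge1).
have g0 : (\int[mu]_(x in Omega) (g x)%:E = 0)%E.
  have := integral_sub_mean mOmega Om p_ge1 m0 mu_ uoo.
  by rewrite /g /a /average Om.
have gge0 : (0 <= pow_int g)%E by exact: pow_int_ge0.
have gfin : pow_int g \is a fin_num by rewrite ge0_fin_numE.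
have Ege0 : (0 <= energy p Omega nu u)%E by exact: energy_ge0.
set i := fine (pow_int g).
have gi : pow_int g = i%:E by rewrite fineK.
rewrite [X in (_ < X)%E -> _]gi => Ei.
have i0 : 0 < i.
  by rewrite -lte_fin; apply: le_lt_trans Ei; rewrite mule_ge0// lee_fin ltW.
(* The inverse of the L^p norm of g. *)
pose k := i `^ (- p^-1).
have k0 : 0 < k by exact: powR_gt0.
have kp : k `^ p = i^-1 by rewrite -powRrM mulNr mulVf ?gt_eqF// powR_inv1 ?ltW.
exists (fun x => k * g x); split.
- exact: measurable_funM.
- rewrite (pow_int_scale mu p mOmega mg (ltW k0)) gi kp -EFinM.
  by rewrite mulVf// gt_eqF.
- under eq_integral do rewrite EFinM.
  rewrite integralZl ?g0 ?mule0//.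
  exact: (pow_int_integrable mOmega Om p_ge1).
- have iV0 : 0 < i^-1 by rewrite invr_gt0.
  apply: (@le_trans _ _ (i^-1%:E * energy p Omega nu u)%E).
    apply: le_energy => // x y Ox Oy xy; rewrite mulrA ler_wpM2r//.
      by apply: nu_ge0; rewrite subr_eq0.
    rewrite -mulrBr normrM (gtr0_norm k0) powRM ?(ltW k0)// kp.
    by rewrite /g opprB addrA subrK.
  rewrite lee_pdivrMl// muleC -lee_pdivrMl ?invr_gt0// invrK.
  exact: ltW.
Qed.

(** The kernel nu is at least 1/k on B, so the indicator of B has energy at most k
times that of nu: both terms that bound the energy of v can be made small
together. *)
Lemma energy_limit_eq0 (B : set 'rV[R]_n) (k m : R) (v : 'rV[R]_n -> R) :
  measurable (B : set (borel_rV R n)) ->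
  (forall h, B h -> h != 0 /\ k^-1 <= nu h) -> 0 < k ->
  mu Omega = m%:E -> mfun v ->
  (forall e : R, 0 < e -> exists w G, [/\ mfun w, pow_int (v \- w) = G%:E,
     G <= e & (energy p Omega nu w <= e%:E)%E]) ->
  energy p Omega \1_B v = 0%E.
Proof.
move=> mB Bnu k0 Om mv lim_v; apply/eqP; rewrite eq_le energy_ge0// andbT.
apply/lee_addgt0Pr => e e0; rewrite add0e.
have m0 : 0 <= m by rewrite -lee_fin -Om.
have K0 : 0 < 3 `^ p * (m *+ 2 + k).
  by rewrite mulr_gt0 ?powR_gt0// ltr_wpDl// mulrn_wge0.
have [w [G [mw wG Ge we]]] := lim_v _ (divr_gt0 e0 K0).
apply: le_trans (energy_indicator_le p_ge1 Omega_open mB mv mw Om wG) _.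
set s := e / _ in Ge we.
have es : e = 3 `^ p * (m * s *+ 2 + k * s).
  have <- : s * (3 `^ p * (m *+ 2 + k)) = e by rewrite divfK ?gt_eqF.
  ring.
rewrite {1}es EFinM lee_pmul2l ?lte_fin ?powR_gt0// [leRHS]EFinD leeD//.
  by rewrite lee_fin lerMn2r ler_wpM2l.
apply: (@le_trans _ _ (k%:E * energy p Omega nu w)%E).
  apply: le_energy => // x y Ox Oy xy.
  rewrite mulrCA ler_wpM2l ?powR_ge0// indicE.
  case: (boolP (_ \in B)) => [|_]; last first.
    by rewrite mulr_ge0 ?(ltW k0)// nu_ge0// subr_eq0.
  by rewrite inE => /Bnu[_ Hk]; rewrite -ler_pdivrMl// mulr1.
by rewrite EFinM lee_pmul2l.
Qed.

Lemma Lp_cvg0_small (w_ : nat -> 'rV[R]_n -> R) v :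
  Lp_norm p Omega (w_ k \- v) @[k --> \oo] --> 0%E ->
  forall (e : R) N, 0 < e -> exists k G,
    [/\ (N <= k)%N, pow_int (w_ k \- v) = G%:E & G <= e].
Proof.
move=> cv e N e0; pose s := e `^ p^-1; have s0 : 0 < s by exact: powR_gt0.
have : nbhs (0%E : \bar R) [set x | (x < s%:E)%E].
  apply: open_nbhs_nbhs; split; first exact: open_ereal_lt_ereal.
  by rewrite /= lte_fin.
move=> /cv [M _ HM]; pose k := maxn M N.
have {HM} /= ks := HM k (leq_maxl _ _).
have ge : (pow_int (w_ k \- v) <= e%:E)%E.
  rewrite -Lp_norm_powE.
  have -> : e%:E = (s%:E `^ p)%E.
    by rewrite poweR_EFin /s -powRrM mulVf ?gt_eqF// powRr1// ltW.
  apply: gt0_ler_poweR;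
    rewrite ?(ltW p_gt0)// ?in_itv/= ?leey ?andbT ?poweR_ge0//.
    by rewrite lee_fin ltW.
  exact: ltW.
have fin : pow_int (w_ k \- v) \is a fin_num.
  by rewrite ge0_fin_numE ?pow_int_ge0//; apply: le_lt_trans ge (ltry _).
exists k, (fine (pow_int (w_ k \- v))); split; first exact: leq_maxr.
  by rewrite fineK.
by rewrite -lee_fin fineK.
Qed.

Lemma poincare (r rho : R) : 0 < r -> rho < r ->
  @measurable_fun _ _ (lebesgue_rV R n) R (~` [set (0 : 'rV[R]_n)]) nu ->
  {ae mu, forall h : 'rV[R]_n, enorm h < r -> 0 < nu h} ->
  (diam Omega <= r%:E)%E \/ rho_connected rho Omega ->
  compact_embedding p Omega nu ->
  exists2 C : R, 0 < C & forall u : 'rV[R]_n -> R, in_Lp p Omega u ->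
    (Lp_norm p Omega (fun x => u x - average Omega u)%R `^ p
      <= C%:E * energy p Omega nu u)%E.
Proof.
move=> r0 rho_r mnu nu_pos hO W_compact.
have [neO|eO] := pselect (Omega !=set0); last first.
  (* Over the empty set both sides vanish. *)
  exists 1 => // u _; rewrite Lp_norm_powE mul1e.
  rewrite (_ : Omega = set0) ?integral_set0 ?energy_ge0//.
  by apply/eqP/negPn/negP => /set0P.
have [m m0 Om] := leb_bounded_open neO.
apply: contrapT => nC.
have /choice[w wP] (k : nat) : exists w, [/\ mfun w, pow_int w = 1%E,
    (\int[mu]_(x in Omega) (w x)%:E = 0)%E &
    (energy p Omega nu w <= k.+1%:R^-1%:E)%E].
  apply: contrapT => nw; apply: nC; exists k.+1%:R; first exact: ltr0Sn.
  move=> u Lu; apply: contrapT => H; apply: nw.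
  exact: normalized_counterexample H.
have wL k : in_Lp p Omega (w k).
  by apply/in_LpP; have [mw -> _ _] := wP k; rewrite ltry.
have w1 k : (energy p Omega nu (w k) <= 1%:E)%E.
  have [_ _ _ /le_trans] := wP k; apply.
  by rewrite lee_fin invf_le1 ?ltr0n// ler1n.
have wW k : in_W p Omega nu (w k).
  by split => //; apply: le_lt_trans (w1 k) _; rewrite ltry.
have wb : exists M : R, forall k, (W_norm p Omega nu (w k) <= M%:E)%E.
  exists (2 `^ p^-1) => k; rewrite /W_norm Lp_norm_powE -poweR_EFin.
  have [_ -> _ _] := wP k.
  apply: gt0_ler_poweR; rewrite ?invr_ge0 ?(ltW p_gt0)// ?in_itv/= ?leey ?andbT.
  - by rewrite adde_ge0// energy_ge0.
  - by rewrite lee_fin.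
  - by rewrite -[2]/(1 + 1) EFinD leeD2l.
have [phi [v [phi_lt /in_LpP[mv voo] cv]]] := W_compact w wW wb.
have phi_ge k : (k <= phi k)%N.
  by elim: k => // k IH; apply: leq_ltn_trans IH _; exact: phi_lt.
have mw k : mfun (w k) by have [] := wP k.
have small := Lp_cvg0_small cv.
have [B [mB Bnu Bcover]] := positive_kernel_cover r0 mnu nu_pos.
have EB k : energy p Omega \1_(B k) v = 0%E.
  apply: (@energy_limit_eq0 _ k.+1%:R m) => //; first exact: Bnu.
  move=> e e0.
  have [N _ /(_ N (leqnn _)) /= Ne] := near_infty_natSinv_lt (PosNum e0).
  have [i [G [Ni wG Ge]]] := small e N e0.
  exists (w (phi i)), G; split; [exact: mw| |exact: Ge|].
    by rewrite -wG; apply: eq_integral => x _; rewrite /= distrC.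
  have [_ _ _ /le_trans] := wP (phi i); apply.
  rewrite lee_fin; apply: le_trans (ltW Ne).
  rewrite lef_pV2 ?posrE ?ltr0n// ler_nat ltnS.
  exact: leq_trans Ni (phi_ge i).
have [c vc] : exists c : R, {ae mu, forall x, Omega x -> v x = c}.
  apply: (ae_constant r0 rho_r Omega_open hO).
  have : {ae mu, forall x, forall k, Omega x ->
      {ae mu, forall y, Omega y -> B k (x - y) -> v x = v y}}.
    apply: ae_foralln => k.
    exact: (energy_indicator_eq0 p_ge1 Omega_open (mB k) mv (EB k)).
  apply: filterS => x Hx Ox.
  have : {ae mu, forall y, forall k, Omega y -> B k (x - y) -> v x = v y}.
    by apply: ae_foralln => k; exact: Hx.
  apply: filterS2 (Bcover x) => y xyB Hy Oy xyr.
  have [->//|xy] := eqVneq x y.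
  have [k Bk] := xyB xyr xy; exact: Hy Bk.
have wc k G : pow_int (w k \- v) = G%:E ->
    pow_int (fun x => w k x - c) = G%:E.
  move=> <-; apply: (@pow_int_ae_eq _ _ _ mu Omega p mOmega
    (fun x => w k x - c) (w k \- v)).
  - by apply: measurable_funB; [exact: mw|exact: measurable_cst].
  - by apply: measurable_funB; [exact: mw|exact: mv].
  - by apply: filterS vc => x Hx Ox; rewrite /= (Hx Ox).
have c0 : c = 0.
  apply/eqP/negPn/negP => cn0.
  (* With this L the bound reads 2 * m <= m + L ^ p * G, which fails for small
     G. *)
  pose L := 2 / `|c|.
  have L0 : 0 < L by rewrite divr_gt0 ?normr_gt0.
  have Lp0 : 0 < L `^ p by exact: powR_gt0.
  have e0 : 0 < m / (2 * L `^ p) by rewrite divr_gt0 ?mulr_gt0.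
  have [k [G [_ /wc wG Ge]]] := small _ 0%N e0.
  have [_ w1' wmean _] := wP (phi k).
  have woo : (pow_int (w (phi k)) < +oo)%E by rewrite w1' ltry.
  have := mean_zero_cst_bound mOmega Om p_ge1 (mw _) wmean woo (ltW L0) wG.
  have -> : L * `|c| = 2 by rewrite /L divfK ?normr_eq0.
  have : L `^ p * G <= m / 2.
    rewrite -ler_pdivlMl//; apply: le_trans Ge _.
    by rewrite invfM mulrA mulrC.
  rewrite mulr_natl mulr2n lerD2l => LpG /le_trans/(_ LpG).
  by rewrite leNgt gtr_pMr// invf_lt1 ?ltrDl ?ltr01 ?addr_gt0.
have h0 : 0 < 2^-1 :> R by rewrite invr_gt0.
have [k [G [_ /wc wG Ge]]] := small _ 0%N h0.
have [_ w1' _ _] := wP (phi k).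
have : pow_int (w (phi k)) = G%:E.
  by rewrite -wG; apply: eq_integral => x _; rewrite c0 subr0.
by rewrite w1' => -[G1]; move: Ge; rewrite -G1 leNgt invf_lt1 ?ltr1n.
Qed.

End poincare.

Theorem theorem7p12 (R : realType) (d : nat) (p r rho : R)
    (Omega : set 'rV[R]_d) (nu : 'rV[R]_d -> R)
    (d_gt0 : (0 < d)%N)
    (p_ge1 : 1 <= p)
    (Omega_open : open Omega)
    (Omega_bounded : bounded_set Omega)
    (nu_ge0 : forall h : 'rV[R]_d, h != 0 -> 0 <= nu h)
    (nu_measurable :
      @measurable_fun _ _ (lebesgue_rV R d) R (~` [set (0 : 'rV[R]_d)]) nu)
    (nu_symmetric : forall h : 'rV[R]_d, h != 0 -> nu h = nu (- h))
    (rho_ge0 : 0 <= rho)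
    (r_gt_rho : rho < r)
    (nu_gt0 : {ae leb R d, forall h : 'rV[R]_d, enorm h < r -> 0 < nu h})
    (Omega_connected : (diam Omega <= r%:E)%E \/ rho_connected rho Omega)
    (W_compact : compact_embedding p Omega nu) :
  exists2 C : R, 0 < C &
    forall u : 'rV[R]_d -> R, in_Lp p Omega u ->
      (Lp_norm p Omega (fun x => u x - average Omega u)%R `^ p
        <= C%:E * energy p Omega nu u)%E.
Proof.
exact: (poincare p_ge1 Omega_open Omega_bounded nu_ge0
  (le_lt_trans rho_ge0 r_gt_rho) r_gt_rho nu_measurable nu_gt0
  Omega_connected W_compact).
Qed.
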